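(* Let $X$ be a topological vector space over $\mathbb{K}$ ($\mathbb{K}=\mathbb{R}$ or $\mathbb{C}$) and let $T\in L(X)$ have the periodic shadowing property (respectively, the strict periodic shadowing property). Then: (a) $\mathrm{Per}(T)$ is dense in $\mathrm{CR}(T)$. (b) $T|_{\mathrm{CR}(T)}$ has the finite shadowing property and the periodic shadowing property (respectively, the finite shadowing property and the strict periodic shadowing property). (c) $T|_{\mathrm{CR}(T)}$ is topologically mixing and Devaney chaotic.
   Context: All topological vector spaces are Hausdorff. $\mathbb{N}_0=\{0,1,2,\dots\}$. $L(X)$ is the set of continuous linear operators on $X$. $\mathrm{Per}(T)$ is the set of periodic points of $T$. For a neighborhood $U$ of $0$, a $U$-chain for $T$ from $x_0$ to $x_k$ is a finite sequence $(x_j)_{j=0}^k$ ($k\ge1$) with $Tx_j-x_{j+1}\in U$ for $0\le j<k$; a sequence $(x_j)_{j\in\mathbb{N}_0}$ with $Tx_j-x_{j+1}\in U$ for all $j$ is a $U$-pseudotrajectory. A point $x$ is chain recurrent for $T$ if for every neighborhood $U$ of $0$ there is a $U$-chain for $T$ from $x$ to itself; $\mathrm{CR}(T)$ is the set of all chain recurrent points. It is known that $\mathrm{CR}(T)$ is a closed $T$-invariant linear subspace of $X$, so $T|_{\mathrm{CR}(T)}$ is regarded as a continuous linear operator on the topological vector space $\mathrm{CR}(T)$. $T$ has the finite shadowing property if for every neighborhood $V$ of $0$ there is a neighborhood $U$ of $0$ such that for every $U$-chain $(x_j)_{j=0}^k$ there is $x\in X$ with $x_j-T^jx\in V$ for all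 $0\le j\le k$. $T$ has the periodic shadowing property if for every neighborhood $V$ of $0$ there is a neighborhood $U$ of $0$ such that for every periodic $U$-pseudotrajectory $(x_j)_{j\in\mathbb{N}_0}$ there is $x\in\mathrm{Per}(T)$ with $x_j-T^jx\in V$ for all $j\in\mathbb{N}_0$; the strict periodic shadowing property additionally requires that $x$ can be chosen with $T^kx=x$ if $(x_j)_{j\in\mathbb{N}_0}$ has period $k$. $T$ is topologically transitive (resp. topologically mixing) if for all nonempty open sets $A,B\subset X$ there is $n\in\mathbb{N}_0$ with $T^n(A)\cap B\ne\emptyset$ (resp. there is $n_0\in\mathbb{N}_0$ with $T^n(A)\cap B\neq\emptyset$ for all $n\ge n_0$). $T$ is Devaney chaotic if it is topologically transitive and $\mathrm{Per}(T)$ is dense in $X$. *)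

(* Defs.v *)
From HB Require Import structures.
From mathcomp Require Import all_boot all_order all_algebra.
From mathcomp Require Import all_classical all_reals.
From mathcomp Require Import topology tvs.
From mathcomp Require Import complex.

Set Implicit Arguments.
Unset Strict Implicit.
Unset Printing Implicit Defensive.

Import Order.TTheory GRing.Theory Num.Theory.

Local Open Scope classical_set_scope.
Local Open Scope ring_scope.

Variant scalars := RealScalars | ComplexScalars.

Definition scalar_field (R : realType) (s : scalars) : numFieldType :=
  match s with
  | RealScalars => R
  | ComplexScalars => R[i]
  end.

Definition Per (X : Type) (T : X -> X) : set X :=
  [set x | exists2 n, (0 < n)%N & iter n T x = x].

Definition dense_in (X : topologicalType) (A B : set X) : Prop :=
  A `<=` B /\ B `<=` closure A.

Definition transitive_map (X : topologicalType) (T : X -> X) : Prop :=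
  forall A B : set X, open A -> open B -> A !=set0 -> B !=set0 ->
    exists n, (iter n T @` A) `&` B !=set0.

Definition mixing_map (X : topologicalType) (T : X -> X) : Prop :=
  forall A B : set X, open A -> open B -> A !=set0 -> B !=set0 ->
    exists n0, forall n, (n0 <= n)%N -> (iter n T @` A) `&` B !=set0.

Definition devaney_chaotic (X : topologicalType) (T : X -> X) : Prop :=
  transitive_map T /\ dense (Per T).

Section PseudoOrbits.
Context (K : numDomainType) (X : topologicalLmodType K).
Implicit Types (T : X -> X) (U : set X) (xs : nat -> X) (x : X).

(* The terms of [xs] of index greater than [k] play no role: [xs] only encodes
   the finite sequence xs 0, ..., xs k. *)
Definition chain T U (k : nat) xs : Prop :=
  (0 < k)%N /\ forall j, (j < k)%N -> U (T (xs j) - xs j.+1).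

Definition pseudotrajectory T U xs : Prop :=
  forall j, U (T (xs j) - xs j.+1).

Definition has_period (k : nat) xs : Prop :=
  (0 < k)%N /\ forall j, xs (j + k)%N = xs j.

Definition CR T : set X :=
  [set x | forall U, nbhs (0 : X) U ->
     exists k xs, [/\ chain T U k xs, xs 0%N = x & xs k = x]].

Definition finite_shadowing T : Prop :=
  forall V, nbhs (0 : X) V -> exists2 U, nbhs (0 : X) U &
    forall k xs, chain T U k xs ->
      exists x, forall j, (j <= k)%N -> V (xs j - iter j T x).

Definition periodic_shadowing T : Prop :=
  forall V, nbhs (0 : X) V -> exists2 U, nbhs (0 : X) U &
    forall xs, pseudotrajectory T U xs -> (exists k, has_period k xs) ->
      exists2 x, Per T x & forall j, V (xs j - iter j T x).

(* [k] is any period of [xs], not necessarily the smallest one. *)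
Definition strict_periodic_shadowing T : Prop :=
  forall V, nbhs (0 : X) V -> exists2 U, nbhs (0 : X) U &
    forall xs k, pseudotrajectory T U xs -> has_period k xs ->
      exists x, [/\ Per T x, forall j, V (xs j - iter j T x)
                  & iter k T x = x].

End PseudoOrbits.

Section ChainRecurrentSubspace.
Context (K : numDomainType) (X : topologicalLmodType K).

Lemma chain_periodize (T : X -> X) (U : set X) k xs x :
  chain T U k xs -> xs 0%N = x -> xs k = x ->
  exists2 ys : nat -> X, pseudotrajectory T U ys & forall l, ys (l * k)%N = x.
Proof.
move=> [k0 xsU] xs0 xsk; exists (fun j => xs (j %% k)%N); last first.
  by move=> l; rewrite modnMl.
move=> j; have jk : (j %% k < k)%N by rewrite ltn_mod.
have := xsU _ jk; rewrite modnS; case: ifPn => // kj.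
suff -> : (j %% k).+1 = k by rewrite xsk xs0.
apply/eqP; rewrite eqn_leq jk dvdn_leq//.
by move: kj; rewrite {1}(divn_eq j k) -addnS dvdn_addr // dvdn_mull.
Qed.

Lemma CR0 (T : {linear X -> X}) : CR T 0.
Proof.
move=> U U0; exists 1%N, (fun=> 0); split=> //; split=> // j _.
by rewrite linear0 subr0; exact: (nbhs_singleton U0).
Qed.

Lemma CRD (T : {linear X -> X}) (x y : X) : CR T x -> CR T y -> CR T (x + y).
Proof.
move=> Tx Ty U U0.
have := @add_continuous X (0, 0) U; rewrite /= addr0 => /(_ U0) [[A B]/= [A0 B0] AB].
have [k [xs [ckx x0 xk]]] := Tx _ A0; have [l [ys [cly y0 yl]]] := Ty _ B0.
have [xs' px xl] := chain_periodize ckx x0 xk.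
have [ys' py yk] := chain_periodize cly y0 yl.
exists (k * l)%N, (fun j => xs' j + ys' j); split.
- split; first by rewrite muln_gt0 ckx.1 cly.1.
  move=> j _; rewrite linearD opprD addrACA.
  by apply: (AB (_, _)); split => /=; [exact: px|exact: py].
- by have := (xl 0%N, yk 0%N); rewrite mul0n mul0n => -[-> ->].
- by rewrite yk mulnC xl.
Qed.

Lemma CRZ (T : {linear X -> X}) (a : K) (x : X) : CR T x -> CR T (a *: x).
Proof.
move=> Tx U U0.
have := @scale_continuous K X (a, 0) U.
rewrite /= scaler0 => /(_ U0) [[A B]/= [A0 B0] AB].
have [k [xs [[k0 ck] x0 xk]]] := Tx _ B0.
exists k, (fun j => a *: xs j); split; [split=> // j jk|by rewrite x0|by rewrite xk].
rewrite linearZ -scalerBr; apply: (AB (_, _)); split => /=; last exact: ck.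
exact: (nbhs_singleton A0).
Qed.

Lemma CR_submod_closed (T : {linear X -> X}) :
  submod_closed (fun x => x \in CR T).
Proof.
split; first by rewrite unfold_in; apply/mem_set; exact: CR0.
move=> a x y; rewrite !unfold_in => /set_mem Tx /set_mem Ty.
by apply/mem_set/CRD => //; exact: CRZ.
Qed.

Lemma CR_invariant (T : {linear X -> X}) (cT : continuous T) (x : X) :
  CR T x -> CR T (T x).
Proof.
move=> Tx U U0; have := cT 0 U; rewrite /= linear0 => /(_ U0) TU0.
have [k [xs [[k0 ck] x0 xk]]] := Tx _ TU0.
exists k, (fun j => T (xs j)); split; [split=> // j jk|by rewrite x0|by rewrite xk].
by rewrite -linearB; exact: ck.
Qed.

(* The subtype [set_type (CR T)] carries the subspace topology. *)
Definition CR_space (T : {linear X -> X}) : Type := set_type (CR T).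

HB.instance Definition _ (T : {linear X -> X}) :=
  SubChoice.on (CR_space T).
HB.instance Definition _ (T : {linear X -> X}) :=
  Topological.copy (CR_space T) (set_type (CR T)).
HB.instance Definition _ (T : {linear X -> X}) :=
  GRing.SubChoice_isSubLmodule.Build K X _ (CR_space T)
    (GRing.submod_closed_semi (CR_submod_closed T)).

Lemma CR_space_val_continuous (T : {linear X -> X}) :
  continuous (val : CR_space T -> X).
Proof. exact: initial_continuous. Qed.

Lemma continuous_CR_space (T : {linear X -> X}) (Y : topologicalType)
    (f : Y -> CR_space T) :
  continuous (fun y => val (f y)) -> continuous f.
Proof.
by move=> /continuousP cf; apply/continuousP => _ [A oA <-]; exact: cf.
Qed.

Lemma CR_space_add_continuous (T : {linear X -> X}) :
  continuous (fun z : CR_space T * CR_space T => z.1 + z.2).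
Proof.
apply: continuous_CR_space => z.
apply: (@continuous_comp _ _ _ (fun z : CR_space T * CR_space T =>
  (val z.1, val z.2)) (fun x : X * X => x.1 + x.2)); last exact: add_continuous.
apply: cvg_pair => /=; apply: continuous_comp;
  by [exact: cvg_fst|exact: cvg_snd|exact: CR_space_val_continuous].
Qed.

Lemma CR_space_scale_continuous (T : {linear X -> X}) :
  continuous (fun z : K^o * CR_space T => z.1 *: z.2).
Proof.
apply: continuous_CR_space => z.
apply: (@continuous_comp _ _ _ (fun z : K^o * CR_space T => (z.1, val z.2))
  (fun x : K^o * X => x.1 *: x.2)); last exact: scale_continuous.
apply: (@cvg_pair _ _ _ _ (nbhs (z.1 : K^o))) => /=; first exact: cvg_fst.
by apply: continuous_comp; [exact: cvg_snd|exact: CR_space_val_continuous].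
Qed.

HB.instance Definition _ (T : {linear X -> X}) :=
  PreTopologicalNmodule_isTopologicalNmodule.Build (CR_space T)
    (@CR_space_add_continuous T).
HB.instance Definition _ (T : {linear X -> X}) :=
  TopologicalNmodule_isTopologicalLmodule.Build K (CR_space T)
    (@CR_space_scale_continuous T).

Definition CR_restr (T : {linear X -> X}) (cT : continuous T) :
    CR_space T -> CR_space T :=
  fun x => SigSub (mem_set (CR_invariant cT (set_valP x))).

Lemma CR_restr_linear (T : {linear X -> X}) (cT : continuous T) :
  linear (CR_restr cT).
Proof. by move=> a x y; apply: val_inj; rewrite /= !linearP. Qed.

HB.instance Definition _ (T : {linear X -> X}) (cT : continuous T) :=
  GRing.isLinear.Build K (CR_space T) (CR_space T) *:%R (CR_restr cT)
    (CR_restr_linear cT).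

Lemma CR_restr_continuous (T : {linear X -> X}) (cT : continuous T) :
  continuous (CR_restr cT).
Proof.
apply: continuous_CR_space => x.
by apply: continuous_comp; [exact: CR_space_val_continuous|exact: cT].
Qed.

End ChainRecurrentSubspace.

(* Main.v *)
(* A chain between two chain recurrent points can always be closed up: if x
   lies on a closed chain (x_j), then ((1 - j/n) x_j) and ((j/n) x_j) are, for n
   large, chains from x to 0 and from 0 to x. Hence every chain with endpoints
   in CR(T) is part of a periodic pseudotrajectory, and periodic shadowing
   traces it by a periodic point, which lies in CR(T). Since a chain from x to
   y may be made to wait at 0 for any number of steps, this also gives mixing. *)
Require Import Defs.
From mathcomp Require Import all_boot all_order all_algebra.
From mathcomp Require Import all_classical all_reals.
From mathcomp Require Import topology tvs.
From mathcomp Require Import complex.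

Set Implicit Arguments.
Unset Strict Implicit.
Unset Printing Implicit Defensive.

Import Order.TTheory GRing.Theory Num.Theory.

Local Open Scope classical_set_scope.
Local Open Scope ring_scope.

(** * Archimedean property of the scalars *)

(** In the order on [R[i]] a positive element has zero imaginary part, so the complex case reduces
    to the real one. *)
Lemma scalar_field_archimedean (R : realType) (s : scalars)
    (e : scalar_field R s) :
  0 < e -> exists n, n.+1%:R^-1 < e.
Proof.
have archiR (d : R) : 0 < d -> exists n, n.+1%:R^-1 < d.
  move=> d0; exists (Num.truncn d^-1).
  rewrite -[ltRHS]invrK ltf_pV2 ?posrE ?invr_gt0 ?ltr0n//.
  exact: truncnS_gt.
case: s e => [|[a b]] /=; first exact: archiR.
rewrite ltcE/= => /andP[/eqP b0 /archiR[n na]]; exists n.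
have -> : n.+1%:R = (n.+1%:R)%:C%C :> R[i] by rewrite rmorph_nat.
by rewrite -fmorphV/= ltcE/= b0 eqxx.
Qed.

(** * Concatenation and periodization of finite paths *)

Section Chains.
Context (X : zmodType).
Implicit Types (T : X -> X) (U : set X) (xs ys : nat -> X) (x y z : X).

Definition cat_seq (m : nat) xs ys (j : nat) : X :=
  if (j < m)%N then xs j else ys (j - m)%N.

Lemma cat_seqL m xs ys j : xs m = ys 0%N -> (j <= m)%N ->
  cat_seq m xs ys j = xs j.
Proof.
rewrite /cat_seq; case: ltngtP => // -> xy _.
by rewrite subnn.
Qed.

Lemma cat_seqR m xs ys j : cat_seq m xs ys (m + j)%N = ys j.
Proof. by rewrite /cat_seq ltnNge leq_addr /= addKn. Qed.

(* Unlike [chain], a path may have length 0. *)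
Definition path_of T U n xs : Prop :=
  forall j, (j < n)%N -> U (T (xs j) - xs j.+1).

Lemma path_cat T U m n xs ys : xs m = ys 0%N ->
  path_of T U m xs -> path_of T U n ys ->
  path_of T U (m + n) (cat_seq m xs ys).
Proof.
move=> xy xsU ysU j; case: (ltnP j m) => [jm _|mj].
  by rewrite !cat_seqL ?(ltnW jm)//; exact: xsU.
rewrite -(subnKC mj) ltn_add2l -addnS !cat_seqR; exact: ysU.
Qed.

Definition reach T U n x y : Prop :=
  exists xs, [/\ path_of T U n xs, xs 0%N = x & xs n = y].

Lemma reach_trans T U m n x y z :
  reach T U m x y -> reach T U n y z -> reach T U (m + n) x z.
Proof.
move=> [xs [xsU x0 xm]] [ys [ysU y0 yn]].
have xy : xs m = ys 0%N by rewrite xm y0.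
exists (cat_seq m xs ys); split; first exact: path_cat.
  by rewrite cat_seqL.
by rewrite cat_seqR.
Qed.

Lemma modn_closed k xs j : xs k = xs 0%N -> (j <= k)%N -> xs (j %% k)%N = xs j.
Proof.
move=> xk; rewrite leq_eqVlt => /predU1P[->|jk]; first by rewrite modnn xk.
by rewrite modn_small.
Qed.

Lemma path_periodic T U k xs : (0 < k)%N -> path_of T U k xs ->
  xs k = xs 0%N -> forall j, U (T (xs (j %% k)%N) - xs (j.+1 %% k)%N).
Proof.
move=> k0 xsU xk j; have jk : (j %% k < k)%N by rewrite ltn_mod.
(* When [(j %% k).+1] equals [k] the index wraps to 0; [modn_closed] absorbs this because
   [xs k = xs 0]. *)
by rewrite -addn1 -modnDml addn1 (@modn_closed _ _ (j %% k).+1)//; exact: xsU.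
Qed.

End Chains.

(** * Neighborhoods of 0 under scalar multiplication *)

Section Scaling.
Context (K : numFieldType) (X : topologicalLmodType K).
Implicit Types (U : set X) (x : X).

Lemma nbhs0_scale_small x U : nbhs (0 : X) U ->
  exists2 e : K, 0 < e & forall a, `|a| < e -> U (a *: x).
Proof.
move=> U0; have := @scale_continuous K X (0, x) U.
rewrite /= scale0r => /(_ U0) [[A B]/= [[e/= e0 eA] Bx] AB].
exists e => // a ae; apply: (AB (_, _)); split => /=; last exact: nbhs_singleton.
by apply: eA => /=; rewrite sub0r normrN.
Qed.

(** This replaces the existence of balanced neighborhoods: continuity of scaling at (0, 0) gives a
    radius [e] and a neighborhood [B], and [W] is [(e / 2) B]. Halving makes [|a| * (e / 2) < e]
    strict when [|a| = 1]. *)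
Lemma nbhs0_scale_unit U : nbhs (0 : X) U ->
  exists2 W, nbhs (0 : X) W & forall a x, `|a| <= 1 -> W x -> U (a *: x).
Proof.
move=> U0; have := @scale_continuous K X (0, 0) U.
rewrite /= scale0r => /(_ U0) [[A B]/= [[e/= e0 eA] B0] AB].
have e2 : 0 < e / 2 by rewrite divr_gt0.
have e2n0 : e / 2 != 0 by rewrite gt_eqF.
exists (fun x => B ((e / 2)^-1 *: x)).
  have c : {for (0 : X), continuous (fun x : X => (e / 2)^-1 *: x)}.
    apply: (@continuous_comp _ _ _ (fun x : X => ((e / 2)^-1 : K^o, x))
      (fun z : K^o * X => z.1 *: z.2)); last exact: scale_continuous.
    apply: (@cvg_pair _ _ _ _ (nbhs ((e / 2)^-1 : K^o)));
      [exact: cvg_cst|exact: cvg_id].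
  by apply: c; rewrite scaler0.
move=> a x a1 Bx; have -> : a *: x = (a * (e / 2)) *: ((e / 2)^-1 *: x).
  by rewrite scalerA mulfK.
apply: (AB (_, _)); split => //=; apply: eA => /=.
rewrite sub0r normrN normrM (gtr0_norm e2).
apply: (@le_lt_trans _ _ (e / 2)); first by rewrite ler_piMl// ltW.
by rewrite ltr_pdivrMr// ltr_pMr// ltr1n.
Qed.

End Scaling.

(** * Elementary facts on periodic points and periodic shadowing *)

Section PeriodicPoints.
Context (K : numDomainType) (X : topologicalLmodType K).

Lemma Per_sub_CR (T : X -> X) : Per T `<=` CR T.
Proof.
move=> x [n n0 Tx] U U0; exists n, (fun j => iter j T x); split=> //.
by split=> // j _; rewrite /= subrr; exact: nbhs_singleton.
Qed.

Lemma strict_periodic_shadowing_weak (T : X -> X) :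
  strict_periodic_shadowing T -> periodic_shadowing T.
Proof.
move=> sT V /sT[U U0 UV]; exists U => // xs xsU [k /(UV _ _ xsU)].
by move=> [x [Px xV _]]; exists x.
Qed.

End PeriodicPoints.

(** * Paths between chain recurrent points and their shadowing *)

Section ChainRecurrence.
Context (R : realType) (s : scalars).
Context (X : topologicalLmodType (scalar_field R s)) (T : {linear X -> X}).
Implicit Types (U V : set X) (x y : X).

Lemma nbhs0_scale_small_family (xs : nat -> X) k U : nbhs (0 : X) U ->
  exists N, forall i a, (i < k)%N -> `|a| <= N.+1%:R^-1 -> U (a *: xs i).
Proof.
move=> U0; elim: k => [|k [N NU]]; first by exists 0%N.
have [e e0 eU] := nbhs0_scale_small (xs k) U0.
have [M Me] := scalar_field_archimedean e0.
exists (maxn N M) => i a; rewrite ltnS leq_eqVlt => /predU1P[->|ik] aNM.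
  apply: eU; apply: le_lt_trans Me; apply: (le_trans aNM).
  by rewrite lef_pV2 ?posrE ?ltr0n// ler_nat ltnS leq_maxr.
apply: NU => //; apply: (le_trans aNM).
by rewrite lef_pV2 ?posrE ?ltr0n// ler_nat ltnS leq_maxl.
Qed.

(** Multiplying a closed chain by slowly varying coefficients changes each jump to [c_j (T x_j -
    x_(j+1)) + (c_j - c_(j+1)) x_(j+1)]. The first term is small since [|c_j| <= 1], the second
    since the chain has only finitely many points. *)
Lemma CR_scaled_reach x U : CR T x -> nbhs (0 : X) U ->
  exists2 n, (0 < n)%N & forall c : nat -> scalar_field R s,
    (forall j, (j < n)%N -> `|c j| <= 1) ->
    (forall j, (j < n)%N -> `|c j - c j.+1| <= n%:R^-1) ->
    reach T U n (c 0%N *: x) (c n *: x).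
Proof.
move=> Tx U0; have := @add_continuous X (0, 0) U; rewrite /= addr0.
move=> /(_ U0) [[A B]/= [A0 B0] AB].
have [W W0 WA] := nbhs0_scale_unit A0.
have [k [xs [[k0 xsW] x0 xk]]] := Tx _ W0.
have xk0 : xs k = xs 0%N by rewrite xk x0.
have [N NB] := nbhs0_scale_small_family xs k B0.
(* Going round the chain [N.+1] times ends at [x] again and makes the coefficient step at most
   [N.+1%:R^-1], the bound required by [NB]. *)
exists (N.+1 * k)%N; first by rewrite muln_gt0.
move=> c c1 cN; exists (fun j => c j *: xs (j %% k)%N); split; first last.
- by rewrite modnMl x0.
- by rewrite mod0n x0.
- move=> j jn; have -> : T (c j *: xs (j %% k)%N) - c j.+1 *: xs (j.+1 %% k)%N =
      c j *: (T (xs (j %% k)%N) - xs (j.+1 %% k)%N)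
      + (c j - c j.+1) *: xs (j.+1 %% k)%N.
    by rewrite linearZ scalerBr scalerBl addrA subrK.
  apply: (AB (_, _)); split => /=.
    by apply: WA; [exact: c1|exact: (@path_periodic X T W)].
  apply: NB; first by rewrite ltn_mod.
  apply: (le_trans (cN _ jn)).
  by rewrite lef_pV2 ?posrE ?ltr0n ?muln_gt0// ler_nat leq_pmulr.
Qed.

Lemma CR_reach0 x U : CR T x -> nbhs (0 : X) U ->
  exists2 n, (0 < n)%N & reach T U n x 0 /\ reach T U n 0 x.
Proof.
move=> Tx U0; have [n n0 nU] := CR_scaled_reach Tx U0; exists n => //.
have nz : n%:R != 0 :> scalar_field R s by rewrite pnatr_eq0 -lt0n.
have frac i : (i <= n)%N -> `|i%:R / n%:R : scalar_field R s| <= 1.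
  by move=> ?; rewrite ger0_norm ?divr_ge0// ler_pdivrMr ?ltr0n// mul1r ler_nat.
have step j : `|j%:R / n%:R - j.+1%:R / n%:R : scalar_field R s| = n%:R^-1.
  by rewrite -mulrBl -[j.+1]addn1 natrD opprD addrA subrr sub0r mulN1r
    normrN ger0_norm ?invr_ge0.
split.
  have := nU (fun j => (n - j)%:R / n%:R).
  rewrite subn0 divff// scale1r subnn mul0r scale0r; apply=> j jn.
    by apply: frac; exact: leq_subr.
  by rewrite distrC -(subnSK jn) step.
have := nU (fun j => j%:R / n%:R).
rewrite mul0r scale0r divff// scale1r; apply=> j jn; first exact/frac/ltnW.
by rewrite step.
Qed.

Lemma CR_reach x y U : CR T x -> CR T y -> nbhs (0 : X) U ->
  exists n0, forall n, (n0 <= n)%N -> reach T U n x y.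
Proof.
move=> Tx Ty U0.
have [m m0 [xm _]] := CR_reach0 Tx U0; have [l l0 [_ yl]] := CR_reach0 Ty U0.
(* The surplus [n - (m + l)] is spent at the fixed point 0, between the two paths. *)
exists (m + l)%N => n mln; rewrite -(subnKC mln) addnAC.
apply: reach_trans yl; apply: reach_trans xm _.
exists (fun=> 0); split=> // j _; rewrite linear0 subr0.
exact: nbhs_singleton.
Qed.

(** Density, finite shadowing and mixing all rest on this lemma. The tracing point is periodic,
    hence available in the subspace. *)
Lemma periodic_shadowing_chain : periodic_shadowing T ->
  forall V, nbhs (0 : X) V -> exists2 U, nbhs (0 : X) U &
    forall k xs, CR T (xs 0%N) -> CR T (xs k) -> path_of T U k xs ->
      exists2 x, Per T x & forall j, (j <= k)%N -> V (xs j - iter j T x).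
Proof.
move=> sT V /sT[U U0 UV]; exists U => // k xs Tx0 Txk xsU.
(* The return path has length [n0.+1] rather than [n0], so that the period [l] is positive even when
   [k = 0]. *)
have [n0 /(_ n0.+1 (leqnSn _)) [ys [ysU y0 yn]]] := CR_reach Txk Tx0 U0.
pose l := (k + n0.+1)%N; pose zs := cat_seq k xs ys.
have l0 : (0 < l)%N by rewrite /l addnS.
have z0 : zs 0%N = xs 0%N by rewrite /zs cat_seqL.
have zl : zs l = zs 0%N by rewrite z0 /zs cat_seqR.
have zsU : path_of T U l zs by exact: path_cat.
have [||x Px xV] := UV (fun j => zs (j %% l)%N).
- exact: (@path_periodic X T U).
- by exists l; split=> // j; rewrite modnDr.
exists x => // j jk; have := xV j.
by rewrite modn_closed// ?(leq_trans jk) ?leq_addr// /zs cat_seqL.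
Qed.

Lemma Per_dense_in_CR : periodic_shadowing T -> dense_in (Per T) (CR T).
Proof.
move=> sT; split; first exact: Per_sub_CR.
move=> x Tx A xA; have := @sub_continuous X (x, 0) A; rewrite /= subr0.
move=> /(_ xA) [[B V]/= [xB V0] BV].
have [U U0 UV] := periodic_shadowing_chain sT V0.
(* A path of length 0 at [x] has no jumps to check, and tracing it yields a periodic point close to
   [x]. *)
have [//|p Pp /(_ 0%N isT)/= pV] := UV 0%N (fun=> x) Tx Tx.
exists p; split => //; have -> : p = x - (x - p) by rewrite subKr.
by apply: (BV (_, _)); split => //=; exact: nbhs_singleton.
Qed.

(** * Transfer to the operator induced on [CR_space T] *)

Section Restriction.
Context (cT : continuous T).
Let X' := CR_space T.

Lemma nbhs_CR_spaceP (x : X') (A : set X') :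
  nbhs x A <-> exists2 B : set X, nbhs (val x) B & val @^-1` B `<=` A.
Proof.
split=> [|[B xB BA]]; last first.
  exact: filterS BA (@CR_space_val_continuous _ _ _ x _ xB).
rewrite nbhsE/= => -[C [[B oB <-] xB] CA]; exists B => //.
exact: open_nbhs_nbhs.
Qed.

Lemma val_iter_CR_restr (x : X') n :
  val (iter n (CR_restr cT) x) = iter n T (val x).
Proof. by elim: n => //= n ->. Qed.

Lemma Per_CR_restr (x : X') : Per (CR_restr cT) x <-> Per T (val x).
Proof.
split=> -[n n0 nx]; exists n => //; first by rewrite -val_iter_CR_restr nx.
by apply: val_inj; rewrite val_iter_CR_restr.
Qed.

(** Shadowing in [X] returns points of [X]; this brings them back into the subspace. *)
Lemma Per_lift (x : X) : Per T x ->
  exists2 x' : X', val x' = x & Per (CR_restr cT) x'.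
Proof.
move=> Px; exists (SigSub (mem_set (Per_sub_CR Px)) : X') => //.
exact/Per_CR_restr.
Qed.

Lemma finite_shadowing_CR_restr :
  periodic_shadowing T -> finite_shadowing (CR_restr cT).
Proof.
move=> sT V' /nbhs_CR_spaceP[V V0 VV'].
have [U U0 UV] := periodic_shadowing_chain sT V0.
exists (val @^-1` U); first by apply/nbhs_CR_spaceP; exists U.
move=> k xs [k0 xsU].
have [||//|x /Per_lift[x' <- _] xV] := UV k (fun j => val (xs j)).
- exact: set_valP.
- exact: set_valP.
by exists x' => j jk; apply: VV'; rewrite /= val_iter_CR_restr; exact: xV.
Qed.

Lemma periodic_shadowing_CR_restr :
  periodic_shadowing T -> periodic_shadowing (CR_restr cT).
Proof.
move=> sT V' /nbhs_CR_spaceP[V /sT[U U0 UV] VV'].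
exists (val @^-1` U); first by apply/nbhs_CR_spaceP; exists U.
move=> xs xsU [k [k0 xsk]].
have [//||x /Per_lift[x' <- Px'] xV] := UV (fun j => val (xs j)).
  by exists k; split=> // j; rewrite xsk.
by exists x' => // j; apply: VV'; rewrite /= val_iter_CR_restr; exact: xV.
Qed.

Lemma strict_periodic_shadowing_CR_restr :
  strict_periodic_shadowing T -> strict_periodic_shadowing (CR_restr cT).
Proof.
move=> sT V' /nbhs_CR_spaceP[V /sT[U U0 UV] VV'].
exists (val @^-1` U); first by apply/nbhs_CR_spaceP; exists U.
move=> xs k xsU [k0 xsk].
have [//||x [/Per_lift[x' <- Px'] xV kx]] := UV (fun j => val (xs j)) k.
  by split=> // j; rewrite xsk.
exists x'; split=> //; last by apply: val_inj; rewrite val_iter_CR_restr.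
by move=> j; apply: VV'; rewrite /= val_iter_CR_restr; exact: xV.
Qed.

Lemma nbhs_CR_sub (x : X') (A : set X') : nbhs x A ->
  exists2 V, nbhs (0 : X) V & forall y : X', V (val x - val y) -> A y.
Proof.
move=> /nbhs_CR_spaceP[B xB BA]; have := @sub_continuous X (val x, 0) B.
rewrite /= subr0 => /(_ xB) [[C V]/= [xC V0] CV]; exists V => // y xyV.
apply: BA => /=; have -> : val y = val x - (val x - val y) by rewrite subKr.
by apply: (CV (_, _)); split => //=; exact: nbhs_singleton.
Qed.

Lemma mixing_CR_restr : periodic_shadowing T -> mixing_map (CR_restr cT).
Proof.
move=> sT A B oA oB [a Aa] [b Bb].
have [V V0 VA] := nbhs_CR_sub (open_nbhs_nbhs (conj oA Aa)).
have [W W0 WB] := nbhs_CR_sub (open_nbhs_nbhs (conj oB Bb)).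
(* Precision [V] is needed at time 0 to start in [A], and precision [W] at time [n] to arrive in
   [B]; one tracing point must satisfy both. *)
have [U U0 UVW] := periodic_shadowing_chain sT (filterI V0 W0).
have [n0 nU] := CR_reach (set_valP a) (set_valP b) U0.
exists n0 => n /nU[xs [xsU xa xb]].
have [||//|x /Per_lift[x' <- _] xV] := UVW n xs.
- by rewrite xa; exact: set_valP.
- by rewrite xb; exact: set_valP.
exists (iter n (CR_restr cT) x'); split.
  by exists x' => //; apply: VA; rewrite -xa; have [] := xV 0%N isT.
by apply: WB; rewrite val_iter_CR_restr -xb; have [] := xV n (leqnn _).
Qed.

Lemma devaney_chaotic_CR_restr :
  periodic_shadowing T -> devaney_chaotic (CR_restr cT).
Proof.
move=> sT; split.
  move=> A B oA oB A0 B0; have [n0 AB] := mixing_CR_restr sT oA oB A0 B0.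
  by exists n0; exact: AB.
move=> A [a Aa] oA.
have /nbhs_CR_spaceP[B aB BA] := open_nbhs_nbhs (conj oA Aa).
have [x [/Per_lift[x' <- Px'] Bx]] := (Per_dense_in_CR sT).2 _ (set_valP a) _ aB.
by exists x'; split => //; exact: BA.
Qed.

End Restriction.

End ChainRecurrence.

Theorem theorem3 (R : realType) (s : scalars)
    (X : topologicalLmodType (scalar_field R s)) (hX : hausdorff_space X)
    (T : {linear X -> X}) (cT : continuous T) :
  (periodic_shadowing T ->
     [/\ dense_in (Per T) (CR T),
         finite_shadowing (CR_restr cT) /\ periodic_shadowing (CR_restr cT)
       & mixing_map (CR_restr cT) /\ devaney_chaotic (CR_restr cT)])
  /\
  (strict_periodic_shadowing T ->
     [/\ dense_in (Per T) (CR T),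
         finite_shadowing (CR_restr cT) /\
         strict_periodic_shadowing (CR_restr cT)
       & mixing_map (CR_restr cT) /\ devaney_chaotic (CR_restr cT)]).
Proof.
split=> [sT|ssT].
  split; first exact: Per_dense_in_CR.
    split; first exact: finite_shadowing_CR_restr.
    exact: periodic_shadowing_CR_restr.
  by split; [exact: mixing_CR_restr|exact: devaney_chaotic_CR_restr].
(* Strictness matters only for the strict shadowing of the restriction; the other conclusions follow
   from the weak property. *)
have sT := strict_periodic_shadowing_weak ssT.
split; first exact: Per_dense_in_CR.
  split; first exact: finite_shadowing_CR_restr.
  exact: strict_periodic_shadowing_CR_restr.
by split; [exact: mixing_CR_restr|exact: devaney_chaotic_CR_restr].
Qed.
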